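(* Let $n\geq 5$. Among all $n$-vertex bicyclic graphs, the graph $B_2'$ has the maximal total-eccentricity index; that is, $\tau(B)\leq \tau(B_2')$ for every $n$-vertex bicyclic graph $B$.
   Context: All graphs are finite and simple. For a connected graph $G$, the eccentricity $e_G(v)$ of a vertex $v$ is the largest distance from $v$ to any other vertex of $G$. The total-eccentricity index of $G$ is $\tau(G)=\sum_{u\in V(G)} e_G(u)$. An $n$-vertex bicyclic graph is a connected graph with $n$ vertices and exactly $n+1$ edges. $B_2'$ is the $n$-vertex bicyclic graph obtained from a path $v_1v_2\ldots v_{n-1}$ on $n-1$ vertices by adding a new vertex $v$ adjacent to exactly $v_1$, $v_2$ and $v_3$. *)

(* Defs.v *)
From HB Require Import structures.
From mathcomp Require Import all_boot.

Set Implicit Arguments.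
Unset Strict Implicit.
Unset Printing Implicit Defensive.

Record sgraph := SGraph {
  vertex :> finType;
  adj : rel vertex;
  adj_sym : symmetric adj;
  adj_irr : irreflexive adj
}.

Section Graph.
Variable G : sgraph.
Implicit Types u v w : G.

Definition edges : {set {set G}} := [set [set p.1; p.2] | p : G * G & adj p.1 p.2].

Definition connected : Prop := forall u v, connect (@adj G) u v.

Definition walk u v (k : nat) : bool :=
  [exists p : k.-tuple G, path (@adj G) u p && (last u p == v)].

(* Least length of a walk from u to v. Searching the lengths below #|G| is
   enough, see distP; the value is #|G| when u and v are not connected. *)
Definition dist u v : nat := find (walk u v) (iota 0 #|G|).

Definition ecc v : nat := \max_(w | w != v) dist v w.

Definition tau : nat := \sum_(u : G) ecc u.

Lemma distP u v : connect (@adj G) u v ->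
  walk u v (dist u v) /\ forall k, walk u v k -> dist u v <= k.
Proof.
move=> /connectP[p0 p0P ->]; case/shortenP: p0P => p pP pU _.
have pw : walk u (last u p) (size p).
  by apply/existsP; exists (in_tuple p); rewrite pP eqxx.
have ltp : size p < #|G| by rewrite -[(size p).+1]/(size (u :: p)) -(card_uniqP pU) max_card.
have has_w : has (walk u (last u p)) (iota 0 #|G|).
  by apply/hasP; exists (size p); rewrite ?mem_iota.
split.
  have := nth_find 0 has_w; rewrite nth_iota //.
  by move: has_w; rewrite has_find size_iota.
move=> k wk; rewrite leqNgt; apply/negP => ltk.
have := before_find 0 ltk; rewrite nth_iota ?wk //.
by apply: leq_trans ltk _; rewrite -[X in _ <= X](size_iota 0) find_size.
Qed.

End Graph.

Definition bicyclic (n : nat) (G : sgraph) : Prop :=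
  [/\ #|G| = n, connected G & #|edges G| = n.+1].

(* [Some i] is the path vertex v_(i+1), and [None] is the added vertex v. *)
Definition B2'_adj (n : nat) (x y : option 'I_n.-1) : bool :=
  match x, y with
  | Some i, Some j => (i.+1 == j) || (j.+1 == i)
  | Some i, None | None, Some i => i < 3
  | None, None => false
  end.

Lemma B2'_adj_sym n : symmetric (@B2'_adj n).
Proof. by move=> [i|] [j|] //=; rewrite orbC. Qed.

Lemma B2'_adj_irr n : irreflexive (@B2'_adj n).
Proof. by move=> [i|] //=; rewrite orbb gtn_eqF. Qed.

Definition B2' (n : nat) : sgraph := SGraph (@B2'_adj_sym n) (@B2'_adj_irr n).

(* Main.v *)
Require Import Defs.
From HB Require Import structures.
From mathcomp Require Import all_boot.
From mathcomp Require Import zify.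

(** Let [B] be bicyclic with [n] vertices, and let [c] be a vertex of minimal
eccentricity [r].

Going through [c] gives [ecc v <= r + dist c v] for every [v]. If [r >= 2], then
in a breadth-first tree rooted at [c] some vertex [x] lies at depth [r], and some
vertex at depth [r - 1] lies in another branch, as otherwise the first vertex on
the way to [x] would have a smaller eccentricity ([two_deep_branches]). The tree
path joining the two has [2 * r] vertices, and summing depths along it yields
[tau B + r ^ 2 <= 2 * n * r] ([tau_radius_bound]). This is at most the value of
[tau] at the extremal graph when [2 * r + 3 <= n].

For the remaining radii the tree path is nearly spanning. One finds, unless the
radius bound improves by the one unit that is missing, either a Hamiltonian path
or a path on [n - 1] vertices whose inner vertices include a neighbour of the
remaining vertex ([arms_pendant_path]). Here the two edges beyond a spanning tree
come into play. Exchanging a path edge for a chord turns a Hamiltonian path into a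
pendant path unless it exhibits a vertex of eccentricity less than half of [n],
which is impossible for these radii ([ham_bound]). For a pendant path,
eccentricities are bounded by those in the tree; this gives the claim, except if
the pendant vertex is attached next to an end, where the bound exceeds the claim
by one and an edge outside the tree saves that one ([pendant_path_bound]).

In the extremal graph, all eccentricities are bounded below by the 1-Lipschitz
position along the path ([B2'_ecc_ge]). *)

Set Implicit Arguments.
Unset Strict Implicit.
Unset Printing Implicit Defensive.

(** * Distances and eccentricities *)

Section Metric.
Variable G : sgraph.
Hypothesis Gconn : connected G.
Implicit Types (u v w : G) (p : nat -> G).

Lemma dist_le_size u (s : seq G) :
  path (@adj G) u s -> dist u (last u s) <= size s.
Proof.
move=> us; have [_] := distP (Gconn u (last u s)); apply.
by apply/existsP; exists (in_tuple s); rewrite us eqxx.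
Qed.

Lemma geodesic u v :
  exists s, [/\ path (@adj G) u s, last u s = v & size s = dist u v].
Proof.
have [/existsP[s /andP[us /eqP lst]] _] := distP (Gconn u v).
by exists s; rewrite size_tuple.
Qed.

Lemma distxx u : dist u u = 0.
Proof. by apply/eqP; rewrite -leqn0; apply: (@dist_le_size u [::]). Qed.

Lemma dist_triangle v u w : dist u w <= dist u v + dist v w.
Proof.
have [s [us <- <-]] := geodesic u v; have [t [vt <- <-]] := geodesic (last u s) w.
by rewrite -size_cat -last_cat; apply: dist_le_size; rewrite cat_path us vt.
Qed.

Lemma dist_adj u v : adj u v -> dist u v <= 1.
Proof. by move=> uv; apply: (@dist_le_size u [:: v]); rewrite /= uv. Qed.

Lemma dist_sym_le u v : dist v u <= dist u v.
Proof.
have [s [us <- <-]] := geodesic u v; elim: s u us => [|w s IHs] u /=.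
  by rewrite distxx.
case/andP=> uw ws; apply: leq_trans (dist_triangle w _ _) _.
by rewrite -addn1 leq_add ?IHs // dist_adj // adj_sym.
Qed.

Lemma dist_sym u v : dist u v = dist v u.
Proof. by apply/eqP; rewrite eqn_leq !dist_sym_le. Qed.

Lemma dist_eq0 u v : dist u v = 0 -> u = v.
Proof. by have [s [_ <- <-]] := geodesic u v; case: s. Qed.

Lemma dist_le_ecc u v : dist u v <= ecc u.
Proof.
have [->|vu] := eqVneq v u; first by rewrite distxx.
exact: (leq_bigmax_cond (F := dist u)).
Qed.

Lemma ecc_leP u k : reflect (forall v, dist u v <= k) (ecc u <= k).
Proof.
apply: (iffP idP) => [uk v|uk]; first exact: leq_trans (dist_le_ecc u v) uk.
by apply/bigmax_leqP => v _; apply: uk.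
Qed.

Lemma ecc_attained u : exists v, dist u v = ecc u.
Proof.
have [/existsP[v uv]|none] := boolP [exists v, ecc u <= dist u v].
  by exists v; apply/eqP; rewrite eqn_leq dist_le_ecc.
have lt v : dist u v < ecc u by rewrite ltnNge; apply: contra none => ?; apply/existsP; exists v.
have : ecc u <= (ecc u).-1 by apply/ecc_leP => v; have := lt v; lia.
by have := lt u; lia.
Qed.

Lemma dist_chain p a b : a <= b ->
  (forall j, a <= j < b -> adj (p j) (p j.+1)) -> dist (p a) (p b) <= b - a.
Proof.
elim: b => [|b IHb]; first by rewrite leqn0 => /eqP-> _; rewrite distxx.
rewrite leq_eqVlt => /predU1P[-> _|ab pP]; first by rewrite distxx.
apply: leq_trans (dist_triangle (p b) _ _) _.
have IH : dist (p a) (p b) <= b - a.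
  by apply: IHb => // j /andP[aj jb]; rewrite pP // aj ltnW.
have : dist (p b) (p b.+1) <= 1 by apply: dist_adj; rewrite pP // -ltnS ab leqnn.
lia.
Qed.

Lemma dist_path p N a b : (forall j, j < N -> adj (p j) (p j.+1)) ->
  a <= N -> b <= N -> dist (p a) (p b) <= (a - b) + (b - a).
Proof.
move=> pP; wlog ab : a b / a <= b => [IH|aN bN].
  by case/orP: (leq_total a b) => ab *; [|rewrite dist_sym addnC]; apply: IH.
apply: leq_trans (dist_chain ab _) _; last by lia.
by move=> j jab; apply: pP; lia.
Qed.

Lemma lipschitz_dist (f : G -> nat) u v :
  (forall x y, adj x y -> f y <= f x + 1) -> f v <= f u + dist u v.
Proof.
move=> fP; have [s [us <- <-]] := geodesic u v.
elim: s u us => [|w s IHs] u /=; first by rewrite addn0.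
by case/andP=> /fP uw /IHs; lia.
Qed.

(** Each vertex reaches all others by passing through [c]. *)
Lemma ecc_le_through c v : ecc v <= ecc c + dist c v.
Proof.
apply/ecc_leP => w; apply: leq_trans (dist_triangle c _ _) _.
by rewrite addnC (dist_sym v) leq_add2r dist_le_ecc.
Qed.

(** A vertex list that contains the whole vertex set bounds every sum from above
even if it repeats vertices, so that coverings can stand for enumerations. *)
Lemma sum_le_cover (F : G -> nat) (s : seq G) :
  (forall v, v \in s) -> \sum_(v : G) F v <= \sum_(v <- s) F v.
Proof.
move=> sP; apply: (@sub_le_big_seq _ _ leq leqnn (fun x y => leq_addr y x)) => v.
by rewrite count_uniq_mem ?index_enum_uniq // (leq_trans (leq_b1 _)) // -has_count has_pred1 sP.
Qed.

End Metric.

(** * Excess edges over a path *)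

(** In a graph with more edges than vertices, a spanning path [q] together with
any one further pair of positions leaves an edge unaccounted for. *)
Lemma chord_exists (G : sgraph) n (q : nat -> G) (e1 e2 : nat) :
  0 < n -> n < #|edges G| -> (forall v, exists2 j, j < n & v = q j) ->
  exists a b, [/\ a.+1 < b < n, (a, b) != (e1, e2) & adj (q a) (q b)].
Proof.
move=> n0 edgesP qP.
pose chord (a b : 'I_n) := [&& a.+1 < b, (val a, val b) != (e1, e2) & adj (q a) (q b)].
have [/existsP[a /existsP[b /and3P[ab abe adj_ab]]]|none] := boolP [exists a, exists b, chord a b].
  by exists a, b; rewrite ab ltn_ord.
pose edge (j : 'I_n) := if j.+1 < n then [set q j; q j.+1] else [set q e1; q e2].
suff /subset_leq_card : edges G \subset edge @: [set: 'I_n].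
  by move/(leq_trans edgesP)/leq_trans/(_ (leq_imset_card _ _)); rewrite cardsT card_ord ltnn.
have last_lt : n.-1 < n by rewrite prednK.
have mem a b : a < b -> b < n -> adj (q a) (q b) -> [set q a; q b] \in edge @: [set: 'I_n].
  move=> ab bn adj_ab; have an := ltn_trans ab bn.
  have [ba|ba] := eqVneq a.+1 b.
    apply/imsetP; exists (Ordinal an) => //; rewrite /edge /=.
    by rewrite ifT ba.
  have [[-> ->]|abe] := eqVneq (a, b) (e1, e2).
    apply/imsetP; exists (Ordinal last_lt) => //; rewrite /edge /=.
    by rewrite ifF // prednK // ltnn.
  case/existsP: none; exists (Ordinal an); apply/existsP; exists (Ordinal bn).
  by rewrite /chord /= ltn_neqAle ba ab abe.
apply/subsetP => _ /imsetP[[u v] /= uv ->].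
have [a an ua] := qP u; have [b bn vb] := qP v; rewrite {}ua {}vb inE /= in uv *.
have [ab|ab|ab] := ltngtP a b; first exact: mem.
  by rewrite setUC; apply: mem; rewrite // adj_sym.
by rewrite ab adj_irr in uv.
Qed.

(** * Spanning paths with one pendant vertex *)

(** The total eccentricity of a path with [m.+1] vertices. *)
Definition path_tau m := \sum_(0 <= j < m.+1) maxn j (m - j).

(** Deleting both ends of a path lowers every other eccentricity by one, hence
the recursion in steps of two. *)
Lemma path_tauSS m : path_tau m.+2 = path_tau m + 3 * m + 5.
Proof.
rewrite /path_tau big_nat_recl // big_nat_recr //=.
rewrite [\sum_(0 <= i < m.+1) maxn i.+1 _](_ : _ = \sum_(0 <= i < m.+1) (maxn i (m - i) + 1)).
  by rewrite big_split /= sum_nat_const_nat; lia.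
by rewrite !big_nat; apply: eq_bigr => i /andP[_ im]; lia.
Qed.

(** Equality holds for even [m]; the bound is used without slack there. *)
Lemma path_tau_ge m : 3 * m ^ 2 + 4 * m <= 4 * path_tau m.
Proof.
have [k mk] := ubnP m; elim: k m mk => // k IHk [|[|m]] mk.
- by [].
- by rewrite /path_tau !big_nat_recr // big_geq.
by rewrite path_tauSS; have := IHk m; nia.
Qed.

Section Spanning.
Variables (m : nat) (B : sgraph).
Hypotheses (m_ge3 : 3 <= m) (Bbic : bicyclic m.+2 B).

Let Bconn : connected B. Proof. by case: Bbic. Qed.

(** A spanning subgraph consisting of the path [p 0, .., p m] and a vertex [w]
attached to an inner vertex [p i]. As the graph has [m.+2] vertices, covering
all of them forces the listed ones to be distinct. *)
Definition pendant_path (p : nat -> B) (w : B) i := [/\ 0 < i < m, adj w (p i),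
  forall j, j < m -> adj (p j) (p j.+1) &
  forall v, v <> w -> exists2 j, j < m.+1 & v = p j].

Section PendantPath.
Variables (p : nat -> B) (w : B) (i : nat).
Hypothesis bpw : pendant_path p w i.

Lemma pendant_path_dist a b : a < m.+1 -> b < m.+1 -> dist (p a) (p b) <= (a - b) + (b - a).
Proof.
by case: bpw => _ _ pP _; move=> am bm; apply: (dist_path Bconn pP).
Qed.

Lemma pendant_path_dist_pendant a : a < m.+1 -> dist w (p a) <= ((a - i) + (i - a)).+1.
Proof.
move=> an; case: (bpw) => ilt wi _ _.
have := dist_triangle Bconn (p i) w (p a); have := dist_adj Bconn wi.
by have := @pendant_path_dist i a; lia.
Qed.

Lemma pendant_path_ecc_path a : a < m.+1 -> ecc (p a) <= maxn a (m - a).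
Proof.
move=> an; apply/(ecc_leP Bconn) => v; case: (bpw) => ilt _ _ cover.
have [->|/eqP/cover[b bn ->]] := eqVneq v w; last by have := @pendant_path_dist a b; lia.
by rewrite dist_sym //; have := pendant_path_dist_pendant an; lia.
Qed.

Lemma pendant_path_ecc_pendant : ecc w <= (maxn i (m - i)).+1.
Proof.
apply/(ecc_leP Bconn) => v; case: (bpw) => ilt _ _ cover.
have [->|/eqP/cover[b bn ->]] := eqVneq v w; first by rewrite distxx.
by have := pendant_path_dist_pendant bn; lia.
Qed.

Lemma pendant_path_tau : tau B <= \sum_(0 <= a < m.+1) ecc (p a) + ecc w.
Proof.
case: bpw => _ _ _ cover.
pose s := w :: [seq p a | a <- index_iota 0 m.+1].
have sP v : v \in s.
  rewrite inE; have [//|/eqP/cover[b bn ->]] := eqVneq v w.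
  by rewrite map_f // mem_index_iota.
by have := sum_le_cover (@ecc B) sP; rewrite big_cons big_map addnC.
Qed.

End PendantPath.

(** Away from the neighbours of the ends, [w] is itself at distance at most
[m.-1] from everything. *)
Lemma pendant_path_tau_inner p w i : pendant_path p w i -> 1 < i < m.-1 ->
  tau B <= path_tau m + m.-1.
Proof.
move=> bpw ilt; apply: leq_trans (pendant_path_tau bpw) _.
rewrite leq_add //; last by apply: leq_trans (pendant_path_ecc_pendant bpw) _; lia.
rewrite /path_tau !big_nat; apply: leq_sum => a an.
exact: (pendant_path_ecc_path bpw).
Qed.

(** When [w] hangs next to an end, [w] and [p 0] are twins in the spanning tree
and both may have eccentricity [m], one too many for the bound. Two edges lie
outside the tree, and only [w]--[p 0] shortens neither the way from [w] to [p m]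
nor the way from [p 0] to [p m]; so one of these eccentricities drops. *)
Lemma pendant_path_tau_outer p w : pendant_path p w 1 -> tau B <= path_tau m + m.-1.
Proof.
move=> bpw; apply: leq_trans (pendant_path_tau bpw) _; case: (bpw) => _ w1 pP cover.
have eccw := pendant_path_ecc_pendant bpw.
have eccp a : a < m.+1 -> ecc (p a) <= maxn a (m - a) by exact: (pendant_path_ecc_path bpw).
have tail : \sum_(0 <= a < m) ecc (p a.+1) <= \sum_(0 <= a < m) maxn a.+1 (m - a.+1).
  by rewrite !big_nat; apply: leq_sum => a an; apply: eccp; lia.
suff [short|short] : ecc w < m \/ ecc (p 0) < m.
- rewrite /path_tau !big_nat_recl //; have := eccp 0; lia.
- rewrite /path_tau !big_nat_recl //; lia.
(* Enumerating [w] before the path makes [w]--[p 0] a consecutive pair and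
   [w]--[p 1] the exceptional pair [(0, 2)]. *)
pose q j := if j is j'.+1 then p j' else w.
have [_ _ edgesB] := Bbic.
have [|||a [b [/andP[ab bn] abe adj_ab]]] := @chord_exists B m.+2 q 0 2.
- by lia.
- by rewrite edgesB.
- move=> v; have [->|/eqP/cover[b bn ->]] := eqVneq v w; [exists 0|exists b.+1] => //; lia.
case: b ab bn abe adj_ab => // b ab bn; case: a ab => [|a] /= ab abe adj_ab.
  left; rewrite -ltnS; suff : ecc w <= m.-1 by lia.
  apply/(ecc_leP Bconn) => v.
  have [->|/eqP/cover[j jn ->]] := eqVneq v w; first by rewrite distxx.
  have [j_last|j_inner] := eqVneq j m; last first.
    by have := pendant_path_dist_pendant bpw jn; lia.
  have b2 : b != 1 by move: abe; rewrite xpair_eqE /=.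
  have := dist_triangle Bconn (p b) w (p j); have := dist_adj Bconn adj_ab.
  have := pendant_path_dist bpw (a := b) (b := j); lia.
right; suff : ecc (p 0) <= m.-1 by lia.
apply/(ecc_leP Bconn) => v.
have [->|/eqP/cover[j jn ->]] := eqVneq v w.
  by rewrite dist_sym //; have := pendant_path_dist_pendant bpw (a := 0); lia.
have := pendant_path_dist bpw (a := 0) (b := j).
have [j_last|j_inner] := eqVneq j m; last by lia.
have := dist_triangle Bconn (p a) (p 0) (p j); have := dist_triangle Bconn (p b) (p a) (p j).
have := dist_adj Bconn adj_ab.
have := pendant_path_dist bpw (a := b) (b := j).
by have := pendant_path_dist bpw (a := 0) (b := a); lia.
Qed.

Lemma pendant_path_rev p w i : pendant_path p w i -> pendant_path (fun j => p (m - j)) w (m - i).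
Proof.
case=> ilt wi pP cover; split; first by lia.
- by rewrite subKn //; lia.
- move=> j jn; rewrite adj_sym (_ : m - j = (m - j.+1).+1); last by lia.
  by apply: pP; lia.
move=> v /cover[j jn ->]; exists (m - j); first by lia.
by congr p; lia.
Qed.

Lemma pendant_path_bound p w i : pendant_path p w i -> tau B <= path_tau m + m.-1.
Proof.
move=> bpw; case: (bpw) => ilt _ _ _.
have [i1|i1] := eqVneq i 1; first by subst i; apply: pendant_path_tau_outer bpw.
have [i2|i2] := eqVneq i m.-1; last by apply: (pendant_path_tau_inner bpw); lia.
move/pendant_path_rev: bpw; rewrite i2 (_ : m - m.-1 = 1); last by lia.
exact: pendant_path_tau_outer.
Qed.

End Spanning.

(** * Hamiltonian paths *)

Section Hamiltonian.
Variables (m : nat) (B : sgraph).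
Hypotheses (m_ge3 : 3 <= m) (Bbic : bicyclic m.+2 B).

Let Bconn : connected B. Proof. by case: Bbic. Qed.

Definition ham_path (q : nat -> B) :=
  (forall j, j < m.+1 -> adj (q j) (q j.+1)) /\
  (forall v, exists2 j, j < m.+2 & v = q j).

(** Dropping the edge [q a]--[q a.+1] in favour of the chord leaves a spider with
hub [q b] and legs of lengths [a.+1], [b - a.+1] and [m.+1 - b]. A leg of length
one is a pendant vertex on the path formed by the two others. If all legs have
length at least two, then no two of them span more than [m.+1 - 2] edges, and
the middle of the spider reaches everything in fewer than half of [m.+2] steps. *)
Lemma ham_chord_bound q a b :
  ham_path q -> a.+1 < b < m.+1 -> adj (q a) (q b) ->
  tau B <= path_tau m + m.-1 \/ exists v : B, ecc v < m.+2./2.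
Proof.
move=> [qP cover] ab adj_ab.
have [a0|a_gt0] := posnP a.
  left; apply: (@pendant_path_bound _ _ m_ge3 Bbic (fun j => q j.+1) (q 0) b.-1).
  split=> [||j jm|v].
  - lia.
  - by rewrite prednK -?a0 //; lia.
  - by apply: qP; lia.
  by have [[|j] jm ->] := cover v => // _; exists j.
have [b2|b_ne] := eqVneq b a.+2.
  left; subst b.
  apply: (@pendant_path_bound _ _ m_ge3 Bbic
    (fun j => if j <= a then q j else q j.+1) (q a.+1) a.+1).
  split=> [||j jm|v].
  - lia.
  - by rewrite ltnn; apply: qP; lia.
  - have [->|ja] := eqVneq j a; first by rewrite leqnn ltnn.
    case: (leqP j a) => ja'; last by rewrite ifF; [apply: qP; lia|lia].
    by rewrite ifT; [apply: qP; lia|lia].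
  have [j jm ->] := cover v => vw.
  have ja : j <> a.+1 by move=> ja; case: vw; rewrite ja.
  case: (leqP j a) => ja'; first by exists j; [lia|rewrite ja'].
  by exists j.-1; [lia | rewrite ifF; [congr q; lia|lia]].
have [bm|bm] := eqVneq b m.
  left; subst b.
  apply: (@pendant_path_bound _ _ m_ge3 Bbic
    (fun j => if j <= a then q j else q (m + a.+1 - j)) (q m.+1) a.+1).
  split=> [||j jm|v].
  - lia.
  - by rewrite ltnn addnK adj_sym; apply: qP; lia.
  - have [->|ja] := eqVneq j a; first by rewrite leqnn ltnn addnK.
    case: (leqP j a) => ja'; last first.
      rewrite ifF; last by lia.
      rewrite adj_sym (_ : m + a.+1 - j = (m + a.+1 - j.+1).+1); last by lia.
      by apply: qP; lia.
    by rewrite ifT; [apply: qP; lia|lia].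
  have [j jm ->] := cover v => vw.
  have ja : j <> m.+1 by move=> ja; case: vw; rewrite ja.
  case: (leqP j a) => ja'; first by exists j; [lia|rewrite ja'].
  by exists (m + a.+1 - j); [lia | rewrite ifF; [congr q; lia|lia]].
right; set k := m.+2./2.
have distq i j : i < m.+2 -> j < m.+2 -> dist (q i) (q j) <= (i - j) + (j - i).
  by move=> im jm; apply: (dist_path Bconn qP).
have detour i j : i < m.+2 -> j < m.+2 ->
    dist (q i) (q j) <= (i - a) + (a - i) + 1 + ((b - j) + (j - b)).
  move=> im jm.
  have := dist_triangle Bconn (q a) (q i) (q j); have := dist_triangle Bconn (q b) (q a) (q j).
  have := dist_adj Bconn adj_ab; have := distq i a; have := distq b j; lia.
have detour' i j : i < m.+2 -> j < m.+2 ->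
    dist (q i) (q j) <= (j - a) + (a - j) + 1 + ((b - i) + (i - b)).
  by move=> im jm; rewrite dist_sym //; apply: detour.
have far i : i < m.+2 -> (forall j, j < m.+2 -> dist (q i) (q j) < k) ->
    exists v : B, ecc v < k.
  move=> im ij; exists (q i).
  have : ecc (q i) <= k.-1.
    by apply/(ecc_leP Bconn) => v; have [j jm ->] := cover v; have := ij j jm; lia.
  by have := ij 0; lia.
(* If some leg has length at least [k], the middle is the vertex of that leg
   at distance [k.-1] from its tip; otherwise the hub will do. *)
have [leg1|leg1] := leqP k a.+1.
  apply: (far k.-1) => [|j jm]; first by lia.
  by have := distq k.-1 j; have := detour k.-1 j; lia.
have [leg2|leg2] := leqP k (b - a.+1).
  apply: (far (a + k)) => [|j jm]; first by lia.
  by have := distq (a + k) j; have := detour' (a + k) j; lia.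
have [leg3|leg3] := leqP k (m.+1 - b).
  apply: (far (m.+2 - k)) => [|j jm]; first by lia.
  by have := distq (m.+2 - k) j; have := detour' (m.+2 - k) j; lia.
apply: (far b) => [|j jm]; first by lia.
by have := distq b j; have := detour' b j; lia.
Qed.

(** Two edges lie outside the path, and at most one of them joins its two ends.
The other one, after reversing the path if necessary, avoids the last vertex. *)
Lemma ham_bound q : ham_path q ->
  tau B <= path_tau m + m.-1 \/ exists v : B, ecc v < m.+2./2.
Proof.
move=> qH; have [qP cover] := qH; have [_ _ edgesB] := Bbic.
have [||a [b [/andP[ab bm] abe adj_ab]]] := @chord_exists B m.+2 q 0 m.+1 _ _ cover.
- by [].
- by rewrite edgesB.
have [b_last|b_inner] := eqVneq b m.+1; last first.
  by apply: (ham_chord_bound qH _ adj_ab); lia.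
have a_gt0 : 0 < a.
  by rewrite lt0n; apply: contra abe => /eqP->; rewrite b_last.
apply: (@ham_chord_bound (fun j => q (m.+1 - j)) 0 (m.+1 - a)).
- split=> [j jm|v].
    by rewrite adj_sym (_ : m.+1 - j = (m.+1 - j.+1).+1); [apply: qP; lia|lia].
  by have [j jm ->] := cover v; exists (m.+1 - j); [lia|congr q; lia].
- lia.
by rewrite subn0 subKn; [rewrite adj_sym -b_last|lia].
Qed.

End Hamiltonian.

(** * Geodesic branches around a central vertex *)

Lemma size_uniq_le (T : finType) (s : seq T) : uniq s -> size s <= #|T|.
Proof. by move/card_uniqP <-; apply: max_card. Qed.

Lemma sum_uniq_le (T : finType) (F : T -> nat) (s : seq T) :
  uniq s -> \sum_(v <- s) F v <= \sum_v F v.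
Proof. by move=> us; rewrite big_uniq //= big_mkcond /=; apply: leq_sum => v _; case: ifP. Qed.

(** The values of [r - dist c v] along a path through [c] that has a branch of
full depth [r] on one side and a branch of depth [r - 1] on the other. *)
Lemma sum_tent r : \sum_(0 <= j < r.*2) (r - ((r - j) + (j - r))) = r ^ 2.
Proof.
elim: r => [|r IHr]; first by rewrite big_geq.
rewrite doubleS big_nat_recl // big_nat_recr //=.
rewrite [X in _ + (X + _)](_ : _ = \sum_(0 <= j < r.*2) (1 + (r - ((r - j) + (j - r))))).
  by rewrite big_split /= IHr sum_nat_const_nat; nia.
by rewrite !big_nat; apply: eq_bigr => j jr; lia.
Qed.

Section Center.
Variables (G : sgraph) (c : G).
Hypothesis Gconn : connected G.
Hypothesis c_central : forall v : G, ecc c <= ecc v.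
Implicit Types u v w : G.

(** A breadth-first spanning tree rooted at [c]. *)
Definition parent v := odflt v [pick u | adj u v && ((dist c u).+1 == dist c v)].

Lemma parentP v : 0 < dist c v ->
  adj (parent v) v /\ (dist c (parent v)).+1 = dist c v.
Proof.
rewrite /parent; case: pickP => [u /andP[uv /eqP //]|none v_gt0].
have [s [cs lst szs]] := geodesic Gconn c v.
case/lastP: s cs lst szs => [|s w]; first by move=> _ _ sz0; rewrite -sz0 in v_gt0.
rewrite rcons_path last_rcons size_rcons => /andP[cs adj_w] wv sz_s; subst w.
case/negP: (negbT (none (last c s))); rewrite adj_w /=.
have := dist_le_size Gconn cs; have := dist_triangle Gconn (last c s) c v.
by have := dist_adj Gconn adj_w; lia.
Qed.

Lemma dist_ancestor t v : t <= dist c v -> dist c (iter t parent v) = dist c v - t.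
Proof.
elim: t => [|t IHt] tv; first by rewrite subn0.
have lev_t := IHt (ltnW tv).
by have [|_] := @parentP (iter t parent v); rewrite lev_t ?iterS; lia.
Qed.

Lemma adj_ancestor t v : t < dist c v ->
  adj (iter t.+1 parent v) (iter t parent v).
Proof. by move=> tv; apply: (parentP _).1; rewrite dist_ancestor; lia. Qed.

Lemma dist_to_ancestor t v : t <= dist c v -> dist (iter t parent v) v <= t.
Proof.
elim: t => [|t IHt] tv; first by rewrite distxx.
have := dist_triangle Gconn (iter t parent v) (iter t.+1 parent v) v.
by have := dist_adj Gconn (adj_ancestor tv); have := IHt; lia.
Qed.

(** The neighbour of [c] through which the chosen geodesic from [c] to [v] starts. *)
Definition branch v := iter (dist c v).-1 parent v.

Lemma branch_ancestor t v : t < dist c v -> branch (iter t parent v) = branch v.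
Proof.
move=> tv; rewrite /branch dist_ancestor ?(ltnW tv) // -iterD.
by congr (iter _ parent v); lia.
Qed.

Lemma dist_branch v : 0 < dist c v -> dist c (branch v) = 1.
Proof. by move=> v_gt0; rewrite dist_ancestor; lia. Qed.

Lemma dist_same_branch u v : 0 < dist c u -> 0 < dist c v -> branch u = branch v ->
  dist u v <= dist c u + dist c v - 2.
Proof.
move=> u_gt0 v_gt0 uv.
have bu : dist (branch u) u <= (dist c u).-1 by apply: dist_to_ancestor; lia.
have bv : dist (branch u) v <= (dist c v).-1 by rewrite uv; apply: dist_to_ancestor; lia.
have := dist_triangle Gconn (branch u) u v; rewrite (dist_sym Gconn u (branch u)).
lia.
Qed.

(** If only one branch came within one of the radius, its first vertex would be
more central than [c]. *)
Lemma two_deep_branches : 1 < ecc c -> exists x y,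
  [/\ dist c x = ecc c, dist c y = (ecc c).-1 & branch x != branch y].
Proof.
move=> r_gt1; have [x xr] := ecc_attained Gconn c.
have [/existsP[y /andP[/eqP yr xy]]|none] :=
  boolP [exists y, (dist c y == (ecc c).-1) && (branch x != branch y)].
  by exists x, y.
have deep y : dist c y = (ecc c).-1 -> branch y = branch x.
  move=> yr; apply/esym/eqP; apply: contraR none => xy.
  by apply/existsP; exists y; rewrite yr eqxx.
have lev1 : dist c (branch x) = 1 by apply: dist_branch; lia.
have near v : dist c v = (ecc c).-1 -> dist (branch x) v <= (ecc c).-2.
  move=> vr; have vx := deep v vr; rewrite -vx.
  have := @dist_to_ancestor (dist c v).-1 v; rewrite -/(branch v); lia.
suff : ecc (branch x) <= (ecc c).-1 by have := c_central (branch x); lia.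
apply/(ecc_leP Gconn) => v; have := dist_le_ecc Gconn c v.
have [vr|vr] := eqVneq (dist c v) (ecc c).-1; first by have := near v vr; lia.
have [vr'|vr'] := eqVneq (dist c v) (ecc c); last first.
  by have := dist_triangle Gconn c (branch x) v; rewrite (dist_sym Gconn (branch x) c); lia.
have [|adj_v lev_v] := @parentP v; first by lia.
have := dist_triangle Gconn (parent v) (branch x) v; have := dist_adj Gconn adj_v.
by have := near (parent v); lia.
Qed.

(** Both cases give [c] at the position [dist c x]. *)
Definition arms x y j :=
  if j <= dist c x then iter j parent x else iter (dist c x + dist c y - j) parent y.

Section Arms.
Variables x y : G.
Hypothesis xy_branch : branch x != branch y.

Lemma dist_arms j : j <= dist c x + dist c y ->
  dist c (arms x y j) = (dist c x - j) + (j - dist c x).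
Proof. by rewrite /arms; case: (leqP j (dist c x)) => xj jxy; rewrite dist_ancestor; lia. Qed.

Lemma arms_adj j : j < dist c x + dist c y -> adj (arms x y j) (arms x y j.+1).
Proof.
move=> jxy; rewrite /arms; case: (ltngtP j (dist c x)) => xj.
- by rewrite adj_sym adj_ancestor.
- rewrite (_ : dist c x + dist c y - j = (dist c x + dist c y - j.+1).+1); last by lia.
  by apply: adj_ancestor; lia.
have top v : iter (dist c v) parent v = c.
  by apply/esym/(dist_eq0 Gconn); rewrite dist_ancestor // subnn.
have := @adj_ancestor (dist c y).-1 y; rewrite xj top prednK ?top; last by lia.
rewrite (_ : dist c x + dist c y - (dist c x).+1 = (dist c y).-1); last by lia.
by apply; lia.
Qed.

Lemma arms_inj i j : i <= dist c x + dist c y -> j <= dist c x + dist c y ->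
  arms x y i = arms x y j -> i = j.
Proof.
wlog ij : i j / i <= j => [IH ixy jxy eq_ij|ixy jxy eq_ij].
  by case/orP: (leq_total i j) => ij; [|symmetry]; apply: IH.
have := congr1 (dist c) eq_ij; rewrite !dist_arms //.
have [jx|jx] := leqP j (dist c x); first by lia.
have [ix|ix] := leqP i (dist c x); last by lia.
move=> lev_ij; case/negP: xy_branch; apply/eqP.
rewrite -(_ : branch (iter i parent x) = branch x); last by apply: branch_ancestor; lia.
move: eq_ij; rewrite /arms ix leqNgt jx /= => ->.
by rewrite branch_ancestor //; lia.
Qed.

Definition arms_seq := [seq arms x y j | j <- index_iota 0 (dist c x + dist c y).+1].

Lemma arms_seq_uniq : uniq arms_seq.
Proof.
rewrite map_inj_in_uniq ?iota_uniq // => i j; rewrite !mem_index_iota => ixy jxy.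
by apply: arms_inj; lia.
Qed.

Lemma arms_seqP v : reflect (exists2 j, j <= dist c x + dist c y & v = arms x y j) (v \in arms_seq).
Proof.
apply: (iffP mapP) => [] [j]; rewrite ?mem_index_iota => jxy ->; exists j => //.
by rewrite mem_index_iota.
Qed.

Lemma arms_size : size arms_seq = (dist c x + dist c y).+1.
Proof. by rewrite size_map size_iota subn0. Qed.

End Arms.

(** Through [c] one gets [ecc v <= r + dist c v], and the two deep branches force
[dist c] to fall short of [r] by [r ^ 2] in total, where [r = ecc c]. The middle
sum records what the first inequality wastes. *)
Lemma tau_radius_bound :
  tau G + \sum_v (ecc c + dist c v - ecc v) + ecc c ^ 2 <= 2 * #|G| * ecc c.
Proof.
have -> : tau G + \sum_v (ecc c + dist c v - ecc v) = \sum_v (ecc c + dist c v).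
  by rewrite -big_split; apply: eq_bigr => v _ /=; rewrite subnKC // ecc_le_through.
have deficit : ecc c ^ 2 <= \sum_v (ecc c - dist c v).
  have [r_le1|r_gt1] := leqP (ecc c) 1.
    by rewrite (bigD1 c) //= distxx // subn0; nia.
  have [x [y [xr yr xy]]] := two_deep_branches r_gt1.
  apply: leq_trans (sum_uniq_le _ (arms_seq_uniq xy)).
  rewrite big_map -sum_tent (_ : (ecc c).*2 = (dist c x + dist c y).+1); last by lia.
  rewrite !big_nat; apply: leq_sum => j jxy.
  by rewrite dist_arms ?xr; lia.
have := leq_add (leqnn (\sum_v (ecc c + dist c v))) deficit.
move/leq_trans; apply; rewrite -big_split /=.
rewrite (eq_bigr (fun=> 2 * ecc c)) => [|v _]; last by have := dist_le_ecc Gconn c v; lia.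
by rewrite sum_nat_const mulnCA mulnA.
Qed.

End Center.

(** * The extremal graph *)

Section Extremal.
Variable m : nat.
Hypothesis m_ge3 : 3 <= m.
Let B := B2' m.+2.

Lemma B2'_connected : connected B.
Proof.
have conn_sym : connect_sym (@adj B) by apply: sym_connect_sym; apply: adj_sym.
suff reach u : connect (@adj B) (Some ord0) u.
  by move=> u v; apply: connect_trans (reach v); rewrite conn_sym.
have pathP j (jm : j < m.+1) : connect (@adj B) (Some ord0) (Some (Ordinal jm)).
  elim: j jm => [|j IHj] jm; first by rewrite (_ : ord0 = Ordinal jm) //; apply: val_inj.
  by apply: connect_trans (IHj (ltnW jm)) (connect1 _); rewrite /= eqxx.
case: u => [[j jm]|]; first exact: pathP.
exact: connect1.
Qed.

Definition B2'_edge (e : 'I_m + 'I_3) : {set B} :=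
  match e with
  | inl i => [set Some (inord i); Some (inord i.+1)]
  | inr i => [set None; Some (inord i)]
  end.

(** The weights make the sums over the edges pairwise distinct: odd and small
on the path, shifted past them at the added vertex. *)
Definition B2'_weight (u : B) : nat := if u is Some i then val i else m.*2.

Lemma B2'_edge_weight e : \sum_(u in B2'_edge e) B2'_weight u =
  match e with inl i => i.*2.+1 | inr i => m.*2 + i end.
Proof.
case: e => [[i im]|[i i3]] /=.
  rewrite big_setU1 ?big_set1 /= ?inordK; [lia|lia|lia|].
  by rewrite inE; apply/eqP => -[] /(congr1 val) /=; rewrite !inordK; lia.
by rewrite big_setU1 ?inE // big_set1 /= inordK; lia.
Qed.

Lemma B2'_edge_inj : injective B2'_edge.
Proof.
move=> e e' ee; have := B2'_edge_weight e; rewrite ee B2'_edge_weight {ee}.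
case: e => i; case: e' => i' /=; have := ltn_ord i; have := ltn_ord i' => ? ? ?.
- by congr inl; apply: val_inj => /=; lia.
- by lia.
- by lia.
by congr inr; apply: val_inj => /=; lia.
Qed.

Lemma B2'_edges : edges B = B2'_edge @: [set: 'I_m + 'I_3].
Proof.
apply/setP=> A; apply/imsetP/imsetP => [[[u v] uv ->]|[[i|i] _ ->]]; last first.
- exists (None, Some (inord i)) => //.
  by rewrite inE /= inordK //; have := ltn_ord i; lia.
- exists (Some (inord i), Some (inord i.+1)) => //.
  by rewrite inE /= !inordK ?eqxx //; have := ltn_ord i; lia.
have path_edge (j k : 'I_m.+1) : j.+1 = k ->
  exists2 e, e \in [set: 'I_m + 'I_3] & [set Some j; Some k] = B2'_edge e.
  move=> jk; have jm : j < m by have := ltn_ord k; lia.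
  exists (inl (Ordinal jm)); rewrite ?inE //= jk.
  by rewrite !inord_val.
have apex_edge (j : 'I_m.+1) : j < 3 ->
  exists2 e, e \in [set: 'I_m + 'I_3] & [set None; Some j] = B2'_edge e.
  by move=> j3; exists (inr (Ordinal j3)); rewrite ?inE //= inord_val.
rewrite inE in uv; case: u v uv => [j|] [k|] //=.
- by case/orP=> /eqP; [|rewrite setUC]; apply: path_edge.
- by rewrite setUC; apply: apex_edge.
exact: apex_edge.
Qed.

Lemma B2'_bicyclic : bicyclic m.+2 B.
Proof.
split; first by rewrite card_option card_ord.
  exact: B2'_connected.
by rewrite B2'_edges card_imset ?cardsT ?card_sum ?card_ord ?addn3 //; exact: B2'_edge_inj.
Qed.

(** Position along the path is 1-Lipschitz once the added vertex is placed level
with the middle one of its three neighbours. *)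
Definition B2'_pos (u : B) : nat := if u is Some i then val i else 1.

Lemma B2'_ecc_ge u : maxn (B2'_pos u) (m - B2'_pos u) <= ecc u.
Proof.
have lip x y : adj x y -> B2'_pos y <= B2'_pos x + 1.
  by case: x y => [i|] [j|] /=; lia.
have lo := lipschitz_dist B2'_connected (Some ord0) u lip.
have hi := lipschitz_dist B2'_connected u (Some ord_max) lip.
have := dist_le_ecc B2'_connected u (Some ord0).
have := dist_le_ecc B2'_connected u (Some ord_max).
by rewrite /= in lo hi; rewrite (dist_sym B2'_connected u (Some ord0)); lia.
Qed.

Lemma B2'_tau_ge : path_tau m + m.-1 <= tau B.
Proof.
rewrite /tau (bigD1 None) //= addnC leq_add //.
  by apply: leq_trans (B2'_ecc_ge _); rewrite /=; lia.
rewrite (reindex_omap Some id) => [|[]] //=.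
rewrite (eq_bigl predT) => [|j]; last by rewrite eqxx.
rewrite /path_tau big_mkord; apply: leq_sum => j _.
exact: (B2'_ecc_ge (Some j)).
Qed.

End Extremal.

(** * The bound *)

Lemma mem_uniq_full (T : finType) (s : seq T) v : uniq s -> size s = #|T| -> v \in s.
Proof.
move=> us sz; apply: contraT => vs.
have /size_uniq_le : uniq (v :: s) by rewrite /= vs.
by rewrite /= sz ltnn.
Qed.

Lemma uniq_missing_one (T : finType) (s : seq T) : uniq s -> (size s).+1 = #|T| ->
  exists2 w, w \notin s & forall v, v <> w -> v \in s.
Proof.
move=> us sz; have [/existsP[w ws]|none] := boolP [exists w, w \notin s].
  exists w => // v /eqP vw.
  have : v \in w :: s by apply: mem_uniq_full; rewrite //= ws.
  by rewrite inE (negPf vw).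
suff : #|T| = size s by lia.
rewrite -(card_uniqP us); apply: eq_card => v.
by rewrite inE; apply/esym; apply: contraR none => vs; apply/existsP; exists v.
Qed.

Section Bound.
Variables (m : nat) (B : sgraph).
Hypotheses (m_ge3 : 3 <= m) (Bbic : bicyclic m.+2 B).

Let Bconn : connected B. Proof. by case: Bbic. Qed.
Let cardB : #|B| = m.+2. Proof. by case: Bbic. Qed.

Section Arms.
Variables c x y : B.
Hypothesis xy_branch : branch c x != branch c y.
Let armsP := arms_adj Bconn (c := c) (x := x) (y := y).

Lemma arms_size_le : dist c x + dist c y < m.+2.
Proof. by rewrite -(arms_size c x y) -cardB; apply: size_uniq_le; apply: arms_seq_uniq. Qed.

Lemma arms_ham : (dist c x + dist c y).+1 = m.+2 -> ham_path m (arms c x y).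
Proof.
move=> full; split=> [j jm|v]; first by apply: armsP; lia.
have /arms_seqP[j jxy ->] : v \in arms_seq c x y.
  by apply: mem_uniq_full; rewrite ?arms_seq_uniq // arms_size full cardB.
by exists j => //; lia.
Qed.

(** The vertex missed by the path hangs from its parent. The parent is not [x],
which has the maximal distance from [c]; if it is [y], the path gets prolonged. *)
Lemma arms_pendant_path : (dist c x + dist c y).+1 = m.+1 -> dist c x = ecc c ->
  (exists w i, pendant_path m (arms c x y) w i) \/
  (dist c y < ecc c /\ exists q, @ham_path m B q).
Proof.
move=> near_full xr.
have [||w ws cover] := @uniq_missing_one B (arms_seq c x y).
- exact: arms_seq_uniq.
- by rewrite arms_size near_full cardB.
have w_gt0 : 0 < dist c w.
  rewrite lt0n; apply: contra ws => /eqP/(dist_eq0 Bconn) <-.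
  apply/arms_seqP; exists (dist c x); first by lia.
  by apply: (dist_eq0 Bconn); rewrite dist_arms //; lia.
have [adj_w lev_w] := parentP Bconn w_gt0.
have /cover/arms_seqP[i ixy wi] : parent c w <> w.
  by move=> pw; rewrite pw adj_irr in adj_w.
rewrite wi in adj_w lev_w; rewrite dist_arms // in lev_w.
have := dist_le_ecc Bconn c w => w_le.
have [i_last|i_inner] := eqVneq i m.
  right; split; first by lia.
  exists (fun j => if j <= m then arms c x y j else w); split=> [j jm|v].
    rewrite -ltnS jm; case: ltnP => jm'; first by apply: armsP; lia.
    by rewrite (_ : j = i) //; lia.
  have [->|/eqP/cover/arms_seqP[j jxy ->]] := eqVneq v w.
    by exists m.+1; rewrite ?ltnn.
  by exists j; [lia|rewrite ifT //; lia].
left; exists w, i; split.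
- by lia.
- by rewrite adj_sym.
- by move=> j jm; apply: armsP; lia.
by move=> v /cover/arms_seqP[j jxy ->]; exists j => //; lia.
Qed.

End Arms.

Lemma exists_center : exists c : B, forall v : B, ecc c <= ecc v.
Proof.
have /card_gt0P[v0 _] : 0 < #|B| by rewrite cardB.
by case: (arg_minnP (@ecc B) (isT : xpredT v0)) => c _ cP; exists c => v; apply: cP.
Qed.

(** With [n = m.+2] and [r = ecc c], the radius bound [r * (2 * n - r)] suffices
as soon as [2 * r + 3 <= n]. For larger [r] the path through two deep branches
misses at most two vertices. If it misses two, either two vertices at distance
[r] lie in different branches and yield a longer path, or all of them share a
branch, which lowers the eccentricity of [x] and improves the radius bound by the
one unit that is needed. *)
Lemma tau_le : tau B <= path_tau m + m.-1.
Proof.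
have [c cP] := exists_center; have bound := tau_radius_bound Bconn cP.
rewrite cardB in bound; have S_ge := path_tau_ge m.
have ham (q : nat -> B) : ham_path m q -> m.+2./2 <= ecc c -> tau B <= path_tau m + m.-1.
  by move=> qH cr; case: (ham_bound m_ge3 Bbic qH) => [//|[v ev]]; have := cP v; lia.
have [small|large] := leqP ((ecc c).*2 + 3) m.+2.
  have [d dm] : exists d, m = (ecc c).*2 + d.+1 by exists (m - (ecc c).*2).-1; lia.
  by subst m; nia.
have r_gt1 : 1 < ecc c by lia.
have [x [y [xr yr xy]]] := two_deep_branches Bconn cP r_gt1.
have size_le := arms_size_le xy.
have [full|not_full] := eqVneq m.+2 (ecc c).*2.
  by apply: (ham (arms c x y)); [apply: arms_ham; lia|lia].
have [near_full|not_near] := eqVneq m.+2 (ecc c).*2.+1.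
  have [|[w [i]]|[_ [q qH]]] := arms_pendant_path xy _ xr; first by lia.
    exact: (pendant_path_bound m_ge3 Bbic).
  by apply: (ham q) => //; lia.
have mr : m = (ecc c).*2 by lia.
have [/existsP[z /andP[/eqP zr xz]]|same] :=
  boolP [exists z, (dist c z == ecc c) && (branch c x != branch c z)].
  have [|[w [i]]|[zlt _]] := arms_pendant_path xz _ xr; first by lia.
    exact: (pendant_path_bound m_ge3 Bbic).
  by rewrite zr ltnn in zlt.
have ecc_x : ecc x < (ecc c).*2.
  suff : ecc x <= (ecc c).*2.-1 by lia.
  apply/(ecc_leP Bconn) => z; have := dist_le_ecc Bconn c z.
  have := dist_triangle Bconn c x z; rewrite (dist_sym Bconn x c).
  have [zr|] := eqVneq (dist c z) (ecc c); last by lia.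
  have [xz|xz] := eqVneq (branch c x) (branch c z); last first.
    by case/existsP: same; exists z; rewrite zr eqxx.
  have : dist x z <= dist c x + dist c z - 2 by apply: dist_same_branch => //; lia.
  by lia.
have : 0 < \sum_v (ecc c + dist c v - ecc v).
  by rewrite (bigD1 x) //= xr; lia.
by move: bound; subst m; nia.
Qed.

End Bound.

Theorem theorem3p7 (n : nat) (hn : 5 <= n) :
  bicyclic n (B2' n) /\
  (forall B : sgraph, bicyclic n B -> tau B <= tau (B2' n)).
Proof.
case: n hn => [|[|m]] // m_ge3; split; first exact: B2'_bicyclic.
by move=> B Bbic; apply: leq_trans (tau_le m_ge3 Bbic) (B2'_tau_ge m_ge3).
Qed.
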